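(* Let $(a,b)$ be an open interval of the real line, let $v, f$ be continuous real-valued functions on $(a,b)$ with $v(t) \ge 0$ and $f(t) \ge 0$ for $a < t < b$, and let $u$ be a positive continuous function on $(a,b)$ which for every $t, \tau \in (a,b)$ satisfies the inequality $$u(t) \le u(\tau) + \int_{\tau}^{t} v(\zeta) u(\zeta)\, |d\zeta| + \int_{\tau}^{t} f(\zeta)\, |d\zeta| .$$ Then for all $t_0, t$ with $a < t_0 \le t < b$ the following inequalities hold: $$u(t_0)\exp\left\{-\int_{t_0}^{t} v(\zeta)\, d\zeta\right\} - \int_{t_0}^{t} \exp\left\{-\int_{\zeta}^{t} v(s)\, ds\right\} f(\zeta)\, d\zeta \le u(t)$$ and $$u(t) \le u(t_0)\exp\left\{\int_{t_0}^{t} v(\zeta)\, d\zeta\right\} + \int_{t_0}^{t} \exp\left\{\int_{\zeta}^{t} v(s)\, ds\right\} f(\zeta)\, d\zeta .$$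
   Context: For a continuous function $g$ on $(a,b)$ and $t,\tau \in (a,b)$, the notation $\int_{\tau}^{t} g(\zeta)\,|d\zeta|$ means the unoriented integral of $g$ over the interval with endpoints $\tau$ and $t$: it equals $\int_{\tau}^{t} g(\zeta)\,d\zeta$ if $t \ge \tau$, and $\int_{t}^{\tau} g(\zeta)\,d\zeta$ if $t \le \tau$. *)

(* Defs.v *)
From Stdlib Require Import Reals.
From Coquelicot Require Import Coquelicot.
Open Scope R_scope.

(* Endpoints are extended reals, so bounded intervals, half-lines and the
   whole line are all covered. *)
Definition in_open_interval (a b : Rbar) (t : R) : Prop :=
  Rbar_lt a t /\ Rbar_lt t b.

(* Real functions on (a,b) are total functions whose values off (a,b) are
   irrelevant; as (a,b) is open, continuity at its points is the same as
   continuity of the restriction. *)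
Definition continuous_on_interval (a b : Rbar) (g : R -> R) : Prop :=
  forall t : R, in_open_interval a b t -> continuous g t.

(* The unoriented integral of g between tau and t, written with |d zeta|. *)
Definition RInt_unoriented (g : R -> R) (tau t : R) : R :=
  if Rle_dec tau t then RInt g tau t else RInt g t tau.

(* Main.v *)
(* Fix t and put W(s) = RInt v s t.  If G' = c (v u + f) with c = 1 or c = -1,
   then Phi(s) = G(s) exp(c W(s)) + c RInt (exp(c W) f) s t has derivative
   c v exp(c W) (u - G), so that u <= G makes Phi monotone.  The upper bound
   takes c = 1 and for G the right-hand side of the hypothesis based at t0; the
   lower bound takes c = -1 and the right-hand side based at t. *)
Require Import Defs.
From Stdlib Require Import Reals.
From Coquelicot Require Import Coquelicot.
From Stdlib Require Import Lra.
Open Scope R_scope.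

Lemma in_open_interval_convex (a b : Rbar) (x y z : R) :
  in_open_interval a b x -> in_open_interval a b y -> x <= z <= y ->
  in_open_interval a b z.
Proof.
intros [hax _] [_ hyb] [hxz hzy]; split.
- exact (Rbar_lt_le_trans a x z hax hxz).
- exact (Rbar_le_lt_trans z y b hzy hyb).
Qed.

Lemma open_in_open_interval (a b : Rbar) : open (in_open_interval a b).
Proof. apply open_and; [apply open_Rbar_gt | apply open_Rbar_lt]. Qed.

Lemma ex_RInt_on_interval (a b : Rbar) (g : R -> R) (x y : R) :
  continuous_on_interval a b g ->
  in_open_interval a b x -> in_open_interval a b y -> ex_RInt g x y.
Proof.
intros hg hx hy; apply (@ex_RInt_continuous R_CompleteNormedModule).
intros z hz; apply hg; revert hz.
unfold Rmin, Rmax; destruct (Rle_dec x y); intros hz.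
- now apply (in_open_interval_convex a b x y).
- now apply (in_open_interval_convex a b y x).
Qed.

Lemma is_derive_RInt_upper (a b : Rbar) (g : R -> R) (x y : R) :
  continuous_on_interval a b g ->
  in_open_interval a b x -> in_open_interval a b y ->
  is_derive (fun s => RInt g x s) y (g y).
Proof.
intros hg hx hy; apply (is_derive_RInt g _ x); [|now apply hg].
(* The fundamental theorem needs the integral to exist for all endpoints near [y]; the open interval
   itself serves as that neighbourhood. *)
apply (filter_imp (in_open_interval a b)); [|now apply open_in_open_interval].
intros z hz; apply (RInt_correct (V := R_CompleteNormedModule)); now apply (ex_RInt_on_interval a b).
Qed.

Lemma is_derive_RInt_lower (a b : Rbar) (g : R -> R) (x y : R) :
  continuous_on_interval a b g ->
  in_open_interval a b x -> in_open_interval a b y ->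
  is_derive (fun s => RInt g s y) x (- g x).
Proof.
intros hg hx hy; apply (is_derive_RInt' g _ x y); [|now apply hg].
apply (filter_imp (in_open_interval a b)); [|now apply open_in_open_interval].
intros z hz; apply (RInt_correct (V := R_CompleteNormedModule)); now apply (ex_RInt_on_interval a b).
Qed.

(** Mean value theorem with [z] in the closed interval, so that the degenerate case [x = y], that is
    [t0 = t] in the theorem, needs no separate treatment. *)
Lemma is_derive_increment (F dF : R -> R) (x y : R) :
  x <= y -> (forall z, x <= z <= y -> is_derive F z (dF z)) ->
  exists z, x <= z <= y /\ F y - F x = dF z * (y - x).
Proof.
intros hxy hF; destruct (MVT_gen F x y dF) as [z hz].
- rewrite Rmin_left, Rmax_right by lra; intros z hz; apply hF; lra.
- rewrite Rmin_left, Rmax_right by lra; intros z hz.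
  apply derivable_continuous_pt; exists (dF z).
  now apply is_derive_Reals, hF.
- rewrite Rmin_left, Rmax_right in hz by lra; now exists z.
Qed.

(** Lets the fundamental theorem differentiate the integral term of Phi. The exponential factor is
    continuous because its exponent is differentiable in the lower limit. *)
Lemma continuous_on_exp_RInt (a b : Rbar) (v f : R -> R) (c t : R) :
  continuous_on_interval a b v -> continuous_on_interval a b f ->
  in_open_interval a b t ->
  continuous_on_interval a b (fun z => exp (c * RInt v z t) * f z).
Proof.
intros hv hf ht z hz; apply (continuous_mult (K := R_AbsRing)); [|now apply hf].
apply (ex_derive_continuous (K := R_AbsRing) (V := R_NormedModule)).
pose proof (is_derive_RInt_lower a b v z t hv hz ht) as hW.
set (W := fun s => RInt v s t) in hW.
change (ex_derive (fun s => exp (c * W s)) z).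
auto_derive; exists (- v z); exact hW.
Qed.

(** The left side is Phi(t) - Phi(t0), and [c * d] is its mean value form. Keeping [c] as a factor
    avoids splitting on its sign: [d <= 0] bounds [G t] from above for c = 1 and from below for c =
    -1. *)
Lemma gronwall_increment (a b : Rbar) (u v f G : R -> R) (c t0 t : R) :
  continuous_on_interval a b v -> continuous_on_interval a b f ->
  in_open_interval a b t0 -> in_open_interval a b t -> t0 <= t ->
  (forall s, t0 <= s <= t -> 0 <= v s) ->
  (forall s, t0 <= s <= t -> is_derive G s (c * (v s * u s + f s))) ->
  (forall s, t0 <= s <= t -> u s <= G s) ->
  exists d, d <= 0 /\
    G t - (G t0 * exp (c * RInt v t0 t)
           + c * RInt (fun z => exp (c * RInt v z t) * f z) t0 t) = c * d.
Proof.
intros hv hf ht0 ht htt hv0 hG huG.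
set (J := fun s => RInt (fun z => exp (c * RInt v z t) * f z) s t).
set (W := fun s => RInt v s t).
destruct (is_derive_increment (fun s => G s * exp (c * W s) + c * J s)
            (fun s => c * (v s * exp (c * W s) * (u s - G s))) t0 t htt)
  as [z [hz e]].
- intros s hs.
  assert (hs' : in_open_interval a b s)
    by now apply (in_open_interval_convex a b t0 t).
  pose proof (hG s hs) as dG.
  assert (dW : is_derive W s (- v s))
    by now apply (is_derive_RInt_lower a b).
  assert (dJ : is_derive J s (- (exp (c * W s) * f s))).
  { apply (is_derive_RInt_lower a b
      (fun z => exp (c * RInt v z t) * f z)); auto.
    now apply continuous_on_exp_RInt. }
  evar_last.
  + auto_derive; [|reflexivity].
    repeat split; eexists; eassumption.
  (* The terms c f exp(c W) coming from G' and from c J' cancel, while W' = -v contributes -c v G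
     exp(c W). *)
  + rewrite (is_derive_unique (fun x : R => G x) _ _ dG),
      (is_derive_unique (fun x : R => W x) _ _ dW),
      (is_derive_unique (fun x : R => J x) _ _ dJ); ring.
- exists (v z * exp (c * W z) * (u z - G z) * (t - t0)); split.
  + assert (0 <= v z * exp (c * W z) * (G z - u z) * (t - t0)).
    { specialize (hv0 z hz); specialize (huG z hz).
      pose proof (exp_pos (c * W z)).
      repeat apply Rmult_le_pos; lra. }
    lra.
  (* At s = t both integrals are over a point, so Phi(t) = G(t). *)
  + assert (eW : W t = 0) by exact (RInt_point t v).
    assert (eJ : J t = 0) by exact (RInt_point t _).
    rewrite eW, eJ, Rmult_0_r, exp_0 in e.
    unfold W, J in *; lra.
Qed.

Theorem corollary1 (a b : Rbar) (u v f : R -> R)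
  (hv : continuous_on_interval a b v)
  (hf : continuous_on_interval a b f)
  (hv0 : forall t : R, in_open_interval a b t -> 0 <= v t)
  (hf0 : forall t : R, in_open_interval a b t -> 0 <= f t)
  (hu : continuous_on_interval a b u)
  (hu0 : forall t : R, in_open_interval a b t -> 0 < u t)
  (hineq : forall t tau : R,
     in_open_interval a b t -> in_open_interval a b tau ->
     u t <= u tau + RInt_unoriented (fun z : R => v z * u z) tau t
            + RInt_unoriented f tau t) :
  forall t0 t : R, Rbar_lt a t0 -> t0 <= t -> Rbar_lt t b ->
    u t0 * exp (- RInt v t0 t)
      - RInt (fun z : R => exp (- RInt v z t) * f z) t0 t <= u t
    /\
    u t <= u t0 * exp (RInt v t0 t)
      + RInt (fun z : R => exp (RInt v z t) * f z) t0 t.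
Proof.
intros t0 t hat0 htt htb.
assert (ht0 : in_open_interval a b t0)
  by (split; [assumption | exact (Rbar_le_lt_trans t0 t b htt htb)]).
assert (ht : in_open_interval a b t)
  by (split; [exact (Rbar_lt_le_trans a t0 t hat0 htt) | assumption]).
assert (hin : forall s, t0 <= s <= t -> in_open_interval a b s)
  by (intros s hs; now apply (in_open_interval_convex a b t0 t)).
assert (hvu : continuous_on_interval a b (fun z => v z * u z)).
{ intros z hz; apply (continuous_mult (K := R_AbsRing)); auto. }
split.
- assert (hb : forall s, t0 <= s <= t ->
      u s <= u t + RInt (fun z => v z * u z) s t + RInt f s t).
  { intros s hs; pose proof (hineq s t (hin s hs) ht) as h.
    revert h; unfold RInt_unoriented; destruct (Rle_dec t s) as [hts|_]; auto.
    (* Here t <= s <= t, and at s = t the orientation of the integrals is immaterial. *)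
    replace s with t by lra; auto. }
  destruct (gronwall_increment a b u v f
    (fun s => u t + RInt (fun z => v z * u z) s t + RInt f s t) (-1) t0 t)
    as [d [hd e]]; auto.
  + intros s hs.
    replace (-1 * (v s * u s + f s)) with (0 + - (v s * u s) + - f s) by ring.
    apply (is_derive_plus (K := R_AbsRing) (V := R_NormedModule));
      [apply (is_derive_plus (K := R_AbsRing) (V := R_NormedModule))|].
    * apply (is_derive_const (K := R_AbsRing) (V := R_NormedModule)).
    * apply (is_derive_RInt_lower a b (fun z => v z * u z)); auto.
    * apply (is_derive_RInt_lower a b); auto.
  (* Based at t, G satisfies G(t) = u(t), so [e] bounds u(t) below in terms of G(t0). It remains to
     replace G(t0) by the smaller u(t0), which is [hb] at t0 multiplied by the positive
     exponential. *)
  + rewrite !RInt_point in e; unfold zero in e; simpl in e.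
    assert (hm : forall x, -1 * x = - x) by (intros; ring).
    assert (hb0 := hb t0 (conj (Rle_refl t0) htt)).
    rewrite (RInt_ext (fun z => exp (-1 * RInt v z t) * f z)
      (fun z => exp (- RInt v z t) * f z)) in e
      by (intros; now rewrite hm).
    rewrite (hm (RInt v t0 t)) in e.
    pose proof (Rmult_le_compat_r _ _ _
      (Rlt_le _ _ (exp_pos (- RInt v t0 t))) hb0).
    lra.
- assert (hb : forall s, t0 <= s <= t ->
      u s <= u t0 + RInt (fun z => v z * u z) t0 s + RInt f t0 s).
  { intros s hs; pose proof (hineq s t0 (hin s hs) ht0) as h.
    revert h; unfold RInt_unoriented.
    destruct (Rle_dec t0 s) as [_|n]; [auto | now destruct n]. }
  destruct (gronwall_increment a b u v f
    (fun s => u t0 + RInt (fun z => v z * u z) t0 s + RInt f t0 s) 1 t0 t)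
    as [d [hd e]]; auto.
  + intros s hs.
    replace (1 * (v s * u s + f s)) with (0 + v s * u s + f s) by ring.
    apply (is_derive_plus (K := R_AbsRing) (V := R_NormedModule));
      [apply (is_derive_plus (K := R_AbsRing) (V := R_NormedModule))|].
    * apply (is_derive_const (K := R_AbsRing) (V := R_NormedModule)).
    * apply (is_derive_RInt_upper a b (fun z => v z * u z)); auto.
    * apply (is_derive_RInt_upper a b); auto.
  (* Based at t0, the equality is G(t0) = u(t0), and the inequality u <= G is used at t instead. *)
  + rewrite !RInt_point in e; unfold zero in e; simpl in e.
    assert (hbt := hb t (conj htt (Rle_refl t))).
    rewrite (RInt_ext (fun z => exp (1 * RInt v z t) * f z)
      (fun z => exp (RInt v z t) * f z)) in e
      by (intros; now rewrite Rmult_1_l).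
    rewrite (Rmult_1_l (RInt v t0 t)), !Rplus_0_r in e.
    lra.
Qed.
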